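(* Let $\{J_\omega\}_{\omega\in\Omega}$ be a family of ergodic Jacobi operators with parameters $\{a_n(\omega),b_n(\omega)\}_n$, let $\Sigma$ be its (almost sure) spectrum and $L$ its Lyapunov exponent. Let $\lambda_m:=\min_{E\in\Sigma}E$ and $\lambda_M:=\max_{E\in\Sigma}E$. If $L$ is $\alpha$-H\''older continuous on the spectrum $\Sigma$ for $0<\alpha<1$, i.e. $$|L(z)-L(w)|\le C|z-w|^{\alpha}$$ for $z,w\in\Sigma$ and $C>0$, then $$\lambda_M-\lambda_m\ge\Big(\frac{|L(\Sigma)|}{C\,4^{1-\alpha}}\Big)^{1/\alpha},$$ where $L(\Sigma):=\{L(E): E\in\Sigma\}$ and $|K|$ denotes the Lebesgue measure of a set $K$.
   Context: Setting. $(\Omega,\mu)$ is a probability measure space and $T:\Omega\to\Omega$ is an ergodic (measure-preserving) transformation. $f,g:\Omega\to\mathbb{R}$ are measurable functions, with $f$ positive, bounded and invertible (i.e. $1/f$ bounded), and $g$ bounded. For $\omega\in\Omega$ and $n\in\mathbb{N}=\{1,2,\dots\}$ put $a_n(\omega)=f(T^n\omega)$ and $b_n(\omega)=g(T^n\omega)$. The Jacobi operator $J_\omega$ is the self-adjoint operator on $\ell^2(\mathbb{N})$ given by $$(J_\omega\psi)_n=a_{n-1}(\omega)\psi_{n-1}+b_n(\omega)\psi_n+a_n(\omega)\psi_{n+1},\qquad n\in\mathbb{N},$$ with the convention $a_0=0$. The family $\{J_\omega\}_{\omega\in\Omega}$ is called an ergodic family of Jacobi operators with parameters $\{a_n(\omega),b_n(\omega)\}_n$.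 Spectrum. $\Sigma\subset\mathbb{R}$ denotes the compact set, independent of $\omega$, such that $\sigma(J_\omega)=\Sigma$ for $\mu$-a.e. $\omega$; it is called the spectrum of $J_\omega$. Lyapunov exponent. For $z\in\mathbb{C}$ set $$A_z(\omega)=\frac{1}{f(T\omega)}\begin{pmatrix} z-g(T\omega) & -f(\omega)\\ f(T\omega) & 0\end{pmatrix},\qquad A_z^n(\omega)=A_z(T^{n-1}\omega)\cdots A_z(T\omega)A_z(\omega),\quad n\ge1.$$ These are the transfer matrices: solutions of $a_{n-1}(\omega)\psi_{n-1}+b_n(\omega)\psi_n+a_n(\omega)\psi_{n+1}=z\psi_n$, $n\ge1$, with $a_0=0$, satisfy $(\psi_{n+1},\psi_n)^{T}=A_z^n(\omega)(\psi_1,\psi_0)^{T}$ with $\psi_0=0$. The Lyapunov exponent $L(z)\in[0,\infty)$ is the number satisfying, for $\mu$-a.e. $\omega$, $$L(z)=\inf_{n\ge1}\frac1n\int_\Omega\log\|A_z^n\|\,d\mu=\lim_{n\to\infty}\frac1n\int_\Omega\log\|A_z^n\|\,d\mu=\lim_{n\to\infty}\frac1n\log\|A_z^n(\omega)\|.$$ *)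

(* Defs.v *)
From mathcomp Require Export complex.
From mathcomp Require Export all_boot all_order all_algebra.
From mathcomp Require Export all_classical all_reals all_analysis.
Export Order.TTheory GRing.Theory Num.Theory.
Export numFieldNormedType.Exports.

Set Implicit Arguments.
Unset Strict Implicit.
Unset Printing Implicit Defensive.

Local Open Scope classical_set_scope.
Local Open Scope ring_scope.
Local Open Scope complex_scope.

Section Dynamics.
Context {d : measure_display} {Omega : measurableType d} {R : realType}.
Variables (P : probability Omega R) (T : Omega -> Omega).

Definition measure_preserving : Prop :=
  measurable_fun setT T /\
  forall A : set Omega, measurable A -> P (T @^-1` A) = P A.

Definition ergodic : Prop :=
  measure_preserving /\
  forall A : set Omega, measurable A -> T @^-1` A = A ->
    P A = 0%E \/ P A = 1%E.

Definition ergodic_jacobi_data (f g : Omega -> R) : Prop :=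
  [/\ ergodic, measurable_fun setT f, measurable_fun setT g
    & [/\ forall w, 0 < f w,
          exists M, forall w, `|f w| <= M,
          exists M, forall w, `|(f w)^-1| <= M
        & exists M, forall w, `|g w| <= M]].

End Dynamics.

(* A sequence (psi_n)_{n >= 1} is stored with a shift: psi_n is [psi n.-1]. *)
Section L2.
Context {R : realType}.
Implicit Types psi phi : nat -> R[i].

Definition l2norm psi : \bar R :=
  ((\sum_(0 <= k <oo) (ComplexField.Normc.normc (psi k) ^+ 2)%:E) `^ 2^-1)%E.

Definition l2 : set (nat -> R[i]) := [set psi | (l2norm psi < +oo)%E].

(* Only the restriction of [A] to [l2] is meaningful. *)
Definition bounded_l2_operator (A : (nat -> R[i]) -> nat -> R[i]) : Prop :=
  [/\ forall psi, l2 psi -> l2 (A psi),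
      forall (c : R[i]) psi phi, l2 psi -> l2 phi ->
        A (fun k => c * psi k + phi k) = (fun k => c * A psi k + A phi k)
    & exists M : R, forall psi, l2 psi ->
        (l2norm (A psi) <= M%:E * l2norm psi)%E].

Definition in_resolvent_set (A : (nat -> R[i]) -> nat -> R[i]) (z : R[i]) :
    Prop :=
  let Az psi := fun k => A psi k - z * psi k in
  exists2 S, bounded_l2_operator S &
    forall psi, l2 psi -> S (Az psi) = psi /\ Az (S psi) = psi.

Definition spectrum (A : (nat -> R[i]) -> nat -> R[i]) : set R[i] :=
  [set z | ~ in_resolvent_set A z].

End L2.

Section Jacobi.
Context {Omega : Type} {R : realType}.
Variables (T : Omega -> Omega) (f g : Omega -> R).

Definition jacobi_a (w : Omega) (n : nat) : R :=
  if n == 0%N then 0 else f (iter n T w).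

Definition jacobi_b (w : Omega) (n : nat) : R := g (iter n T w).

(* Row n = k.+1 of J_w, in the shifted indexing; for k = 0 the first summand
   vanishes because a_0 = 0. *)
Definition jacobi (w : Omega) (psi : nat -> R[i]) : nat -> R[i] :=
  fun k => (jacobi_a w k)%:C * psi k.-1
         + (jacobi_b w k.+1)%:C * psi k
         + (jacobi_a w k.+1)%:C * psi k.+1.

Definition transfer (z : R[i]) (w : Omega) : 'M[R[i]]_2 :=
  ((f (T w))^-1)%:C *:
  \matrix_(i < 2, j < 2)
    nth 0 (nth [::] [:: [:: z - (g (T w))%:C; - (f w)%:C];
                        [:: (f (T w))%:C    ; 0         ]] i) j.

Fixpoint transfer_iter (z : R[i]) (n : nat) (w : Omega) : 'M[R[i]]_2 :=
  if n is m.+1 then transfer z (iter m T w) *m transfer_iter z m w else 1%:M.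

End Jacobi.

Section OperatorNorm.
Context {R : realType} {n : nat}.

Definition euclid_norm (v : 'cV[R[i]]_n) : R :=
  Num.sqrt (\sum_(i < n) ComplexField.Normc.normc (v i 0) ^+ 2).

Definition opnorm (A : 'M[R[i]]_n) : R :=
  sup [set euclid_norm (A *m v) | v in [set v | euclid_norm v <= 1]].

End OperatorNorm.

Section Asymptotics.
Context {d : measure_display} {Omega : measurableType d} {R : realType}.
Variables (P : probability Omega R) (T : Omega -> Omega) (f g : Omega -> R).

Definition log_norm (z : R[i]) (n : nat) (w : Omega) : R :=
  ln (opnorm (transfer_iter T f g z n w)).

Definition mean_log_norm (z : R[i]) (n : nat) : \bar R :=
  ((n%:R^-1)%:E * \int[P]_w (log_norm z n w)%:E)%E.

Definition is_lyapunov_exponent (L : R[i] -> R) : Prop :=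
  forall z : R[i],
  [/\ 0 <= L z,
      (L z)%:E = ereal_inf [set mean_log_norm z n | n in [set n | (1 <= n)%N]],
      mean_log_norm z n @[n --> \oo] --> (L z)%:E
    & {ae P, forall w, n%:R^-1 * log_norm z n w @[n --> \oo] --> L z}].

Definition is_ae_spectrum (Sigma : set R) : Prop :=
  compact Sigma /\
  {ae P, forall w, spectrum (jacobi T f g w) = [set x%:C | x in Sigma]}.

End Asymptotics.

Definition is_min {R : realType} (A : set R) (m : R) : Prop :=
  A m /\ lbound A m.

Definition is_max {R : realType} (A : set R) (m : R) : Prop :=
  A m /\ ubound A m.

(* Main.v *)
Require Import Defs.

Local Open Scope classical_set_scope.
Local Open Scope ring_scope.
Local Open Scope complex_scope.

(** The Lebesgue measure of a set of reals is at most its diameter: the set lies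
    in the closed interval between its infimum and its supremum. A function that
    is Hölder on [Sigma] with exponent [alpha] and constant [C] spreads its
    values on [Sigma] over a range of diameter at most [C * s `^ alpha], where
    [s = lambda_M - lambda_m] is the diameter of [Sigma]. Hence
    [|L(Sigma)| <= C * s `^ alpha], and solving for [s] gives
    [(|L(Sigma)| / C) `^ alpha^-1 <= s]. This is stronger than the claimed bound
    because [1 <= 4 `^ (1 - alpha)]. *)

(** Monotonicity holds without measurability: [lebesgue_measure] is the outer
    measure generated by the lengths of intervals. *)
Lemma le_lebesgue_measure (R : realType) (A B : set R) :
  A `<=` B -> (lebesgue_measure A <= lebesgue_measure B)%E.
Proof. by move=> AB; exact: le_mu_ext. Qed.

(** [A] is contained in the interval from [inf A] to [sup A], and taking suprema
    and infima in the bound on differences gives [sup A - inf A <= D]. *)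
Lemma lebesgue_measure_le_diam (R : realType) (A : set R) (D : R) :
  A !=set0 -> (forall x y, A x -> A y -> y - x <= D) ->
  (lebesgue_measure A <= D%:E)%E.
Proof.
move=> A0 AD; have [a Aa] := A0.
have lbA y : A y -> lbound A (y - D).
  by move=> Ay x Ax; rewrite lerBlDr -lerBlDl AD.
have infA : has_lbound A by exists (a - D); exact: lbA.
have ubA : ubound A (inf A + D).
  by move=> y Ay; rewrite -lerBlDr; apply: lb_le_inf => //; exact: lbA.
have supA : has_ubound A by exists (inf A + D).
have A_itv : A `<=` `[inf A, sup A]%classic.
  by move=> x Ax; rewrite /= in_itv/= ge_inf//= ub_le_sup.
apply: (le_trans (le_lebesgue_measure _ _ _ A_itv)).
rewrite lebesgue_measure_itv/= lte_fin; case: ifP => _.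
  by rewrite -EFinB lee_fin lerBlDl; exact: ge_sup.
by rewrite lee_fin (le_trans _ (AD _ _ Aa Aa))// subrr.
Qed.

(** On [S] the distances, hence the distances of the images, are controlled by
    those between the two extremal points, so the diameter bound applies. *)
Lemma lebesgue_measure_holder_image (R : realType) (h : R -> R) (S : set R)
    (a b C alpha : R) :
  is_min S a -> is_max S b -> 0 <= alpha -> 0 <= C ->
  (forall z w, S z -> S w -> `|h z - h w| <= C * `|z - w| `^ alpha) ->
  (lebesgue_measure (h @` S) <= (C * (b - a) `^ alpha)%:E)%E.
Proof.
move=> [Sa aS] [_ Sb] alpha0 C0 hS.
apply: lebesgue_measure_le_diam; first by exists (h a), a.
move=> _ _ [w Sw <-] [z Sz <-].
apply: (le_trans (ler_norm _)); apply: (le_trans (hS _ _ Sz Sw)).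
have ab : 0 <= b - a by rewrite subr_ge0; exact: Sb.
apply: ler_wpM2l => //; apply: ge0_ler_powR; rewrite ?nnegrE//.
have [az aw] := (aS _ Sz, aS _ Sw); have [zb wb] := (Sb _ Sz, Sb _ Sw).
by rewrite ler_norml opprB !lerB.
Qed.

Theorem theorem3p9 (d : measure_display) (Omega : measurableType d)
    (R : realType) (P : probability Omega R) (T : Omega -> Omega)
    (f g : Omega -> R) (Sigma : set R) (L : R[i] -> R)
    (lambda_m lambda_M C alpha : R)
    (hfg : ergodic_jacobi_data P T f g)
    (hSigma : is_ae_spectrum P T f g Sigma)
    (hL : is_lyapunov_exponent P T f g L)
    (hm : is_min Sigma lambda_m) (hM : is_max Sigma lambda_M)
    (halpha0 : 0 < alpha) (halpha1 : alpha < 1) (hC : 0 < C)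
    (hholder : forall z w : R, Sigma z -> Sigma w ->
      `|L z%:C - L w%:C| <= C * `|z - w| `^ alpha) :
  ((lebesgue_measure [set L E%:C | E in Sigma]
      * ((C * 4 `^ (1 - alpha))^-1)%:E) `^ alpha^-1
   <= (lambda_M - lambda_m)%:E)%E.
Proof.
have [[m_in _] [_ M_ub]] := (hm, hM).
have s0 : 0 <= lambda_M - lambda_m by rewrite subr_ge0; exact: M_ub.
have four1 : 1 <= 4 `^ (1 - alpha) :> R.
  rewrite -[leLHS](powRr0 (4 : R)); apply: ler_powR; first by rewrite ler1n.
  by rewrite subr_ge0 ltW.
have C4_gt0 : 0 < C * 4 `^ (1 - alpha).
  by rewrite mulr_gt0// (lt_le_trans _ four1).
have LSigma : (lebesgue_measure [set L E%:C | E in Sigma]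
    <= (C * (lambda_M - lambda_m) `^ alpha)%:E)%E.
  exact: (lebesgue_measure_holder_image _ _ _ _ _ _ _ hm hM
    (ltW halpha0) (ltW hC) hholder).
have le_s : (lebesgue_measure [set L E%:C | E in Sigma]
    * ((C * 4 `^ (1 - alpha))^-1)%:E <= ((lambda_M - lambda_m) `^ alpha)%:E)%E.
  apply: (le_trans (lee_wpmul2r _ LSigma)); first by rewrite lee_fin invr_ge0 ltW.
  rewrite -EFinM lee_fin ler_pdivrMr// mulrCA ler_wpM2l ?(ltW hC)//.
  by rewrite ler_peMr ?powR_ge0.
have -> : lambda_M - lambda_m = (lambda_M - lambda_m) `^ alpha `^ alpha^-1.
  by rewrite -powRrM mulfV ?gt_eqF// powRr1.
rewrite -poweR_EFin; apply: gt0_ler_poweR => //.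
- by rewrite invr_ge0 ltW.
- by rewrite in_itv/= leey andbT mule_ge0// ?lee_fin ?invr_ge0 ?(ltW C4_gt0)//.
- by rewrite in_itv/= leey andbT lee_fin powR_ge0.
Qed.
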